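(* Let $r\ge2$ and let $\phi$ be a nonzero rational number. The unique solution $R(z)=\sum_{m=0}^\infty R_mz^m\in\mathrm{End}(V_r)[[z]]$ of the equations $$[R_{m+1},\xi]=(m+\mu)R_m\qquad(m\ge0)$$ with the initial condition $R_0=1$ has coefficients $$R^a_a=\mathbf B^{\rm even}_{r,r-2-a}(\phi^{-r/2}z),\qquad a\in\{0,\dots,r-2\},$$ on the main diagonal, $$R^{r-2-a}_a=-\mathbf B^{\rm odd}_{r,a}(\phi^{-r/2}z),\qquad a\in\{0,\dots,r-2\},$$ on the antidiagonal (if $r$ is even, the coefficient at the intersection of both diagonals is $1$), and $0$ everywhere else. The inverse matrix $R^{-1}(z)$ has coefficients $$(R^{-1})^a_a=\mathbf B^{\rm even}_{r,a}(\phi^{-r/2}z),\qquad (R^{-1})^{r-2-a}_a=\mathbf B^{\rm odd}_{r,a}(\phi^{-r/2}z),\qquad a\in\{0,\dots,r-2\},$$ on the main diagonal and the antidiagonal respectively (if $r$ is even, the coefficient at the intersection of both diagonals is $1$), and $0$ everywhere else.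
   Context: $V_r$ has basis $\widehat\partial_0,\dots,\widehat\partial_{r-2}$; matrix coefficients are in this basis, with superscript the row index and subscript the column index. Fix a choice of root $\phi^{1/2}$. The matrices $\xi$ and $\mu$ are: $\xi^a_{r-2-a}=2\phi^{r/2}$ for $a\in\{0,\dots,r-2\}$, all other entries of $\xi$ zero; $\mu$ is diagonal with $\mu^a_a=\frac{2a-r+2}{2r}$. (They are the operator of quantum multiplication by the Euler field and the Hodge grading operator of the Frobenius manifold of Witten's $r$-spin theory at the point $\tau=(0,\dots,0,r\phi)$, in the frame $\widehat\partial_a=\phi^{-(2a-r+2)/4}\partial_a$.) For $a\in\{0,\dots,r-2\}$, $$\mathbf B_{r,a}(T)=\sum_{m=0}^\infty\Bigl[\prod_{i=1}^m\frac{((2i-1)r-2(a+1))((2i-1)r+2(a+1))}{i}\Bigr]\Bigl(-\frac{T}{16r^2}\Bigr)^m,$$ and $\mathbf B^{\rm even}_{r,a}$, $\mathbf B^{\rm odd}_{r,a}$ are its even and odd parts in $T$. *)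

(* Defs.v *)
From mathcomp Require Import all_boot all_order all_algebra.

Set Implicit Arguments.
Unset Strict Implicit.
Unset Printing Implicit Defensive.

Import GRing.Theory.
Local Open Scope ring_scope.

(* A formal power series is its sequence of coefficients. *)
Definition series (A : Type) := nat -> A.

Section ScalarSeries.
Variable K : fieldType.
Implicit Types (f : series K) (c : K).

Definition zero_series : series K := fun _ => 0.
Definition one_series : series K := fun n => (n == 0%N)%:R.
Definition even_part f : series K := fun n => if odd n then 0 else f n.
Definition odd_part f : series K := fun n => if odd n then f n else 0.
Definition opp_series f : series K := fun n => - f n.
(* f(T) |-> f(c z) *)
Definition rescale c f : series K := fun n => f n * c ^+ n.

(* B_{r,a}(T) *)
Definition B (r a : nat) : series K := fun m =>
  (\prod_(1 <= i < m.+1)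
     (((2 * i%:R - 1) * r%:R - 2 * (a%:R + 1)) *
      ((2 * i%:R - 1) * r%:R + 2 * (a%:R + 1)) / i%:R))
  * (- (16 * r%:R ^+ 2)^-1) ^+ m.

Definition Beven r a : series K := even_part (B r a).
Definition Bodd r a : series K := odd_part (B r a).

End ScalarSeries.

(* End(V_r)[[z]], an endomorphism being its matrix in the basis indexed by
   0, ..., r-2, i.e. by 'I_(r.-1).  The entry X^a_b is X a b, and the index
   r-2-a is rev_ord a. *)
Section MatrixSeries.
Variables (K : fieldType) (n : nat).
Implicit Types R S : series 'M[K]_n.

Definition one_mxseries : series 'M[K]_n :=
  fun m => if m == 0%N then 1%:M else 0.

Definition mul_mxseries R S : series 'M[K]_n :=
  fun m => \sum_(i < m.+1) R i *m S (m - i)%N.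

Definition inverse_mxseries R S : Prop :=
  mul_mxseries R S =1 one_mxseries /\ mul_mxseries S R =1 one_mxseries.

Definition entry R (a b : 'I_n) : series K := fun m => R m a b.

(* R has entries diag a at (a, a), anti a at (rev_ord a, a), 1 where the two
   diagonals meet, and 0 elsewhere.  The diagonals meet, for r = n.+1, iff r is
   even, and then at the unique a with rev_ord a = a; there the antidiagonal
   formula does not apply. *)
Definition has_entries R (diag anti : 'I_n -> series K) : Prop :=
  [/\ forall a, entry R a a =1 diag a,
      forall a, rev_ord a != a -> entry R (rev_ord a) a =1 anti a,
      forall a, rev_ord a = a -> entry R a a =1 one_series K &
      forall a b, b != a -> b != rev_ord a -> entry R b a =1 zero_series K].

End MatrixSeries.

Section Frobenius.
Variables (K : fieldType) (r : nat) (s : K). (* s = phi^{1/2} *)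

Definition xi : 'M[K]_(r.-1) :=
  \matrix_(a, b) if b == rev_ord a then 2 * s ^+ r else 0.

Definition mu : 'M[K]_(r.-1) :=
  diag_mx (\row_a ((2 * (a : nat)%:R - r%:R + 2) / (2 * r%:R))).

Definition solution (R : series 'M[K]_(r.-1)) : Prop :=
  R 0%N = 1%:M /\
  forall m : nat,
    R m.+1 *m xi - xi *m R m.+1 = (m%:R%:M + mu) *m R m.

End Frobenius.

(* Main.v *)
Require Import Defs.
From mathcomp Require Import all_boot all_order all_algebra.
From mathcomp Require Import ring zify.
Set Implicit Arguments.
Unset Strict Implicit.
Unset Printing Implicit Defensive.
Import GRing.Theory.
Local Open Scope ring_scope.

(** The antidiagonal involution J of V_r maps the a-th basis vector to the
    rev_ord a-th one.  Since xi = 2 phi^(r/2) J and J mu J = - mu, comparing the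
    equation [R_(m+1), xi] = (m + mu) R_m with its conjugate by J gives
    (m + mu) R_m + (m - mu) J R_m J = 0.  For m >= 1 the previous equation
    expresses R_m - J R_m J through R_(m-1); eliminating J R_m J leaves
      4 m phi^(r/2) R_m = (m - mu) (m - 1 + mu) R_(m-1) J.
    So every entry of R_m is a scalar multiple of a single entry of R_(m-1)
    ([commutator_eq_rec]), which gives uniqueness; and conversely this
    recursion, started at the identity, solves the commutator equations
    ([rec_commutator_eq]).

    Because R_0 = 1, the iterates J^m spread R_m over the diagonal for m even
    and over the antidiagonal for m odd.  The coefficient in row a is the
    product of the factors (i - mu_a) (i - 1 + mu_a) / (4 i phi^(r/2)), and
    these are, up to sign and rescaling of the variable, the factors of the
    hypergeometric series B_(r, r-2-a) ([B_rev_rec]): for A' = 2 (r-2-a+1), the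
    product (i - mu_a) (i - 1 + mu_a) equals
    ((2i-1) r - A') ((2i-1) r + A') / (4 r^2).

    The inverse is the adjoint of R(-z) for the pairing with matrix J (the
    symplectic condition).  Put S(z) = J R(-z)^T J and C = S R.  Transposing the
    equations of R shows [S_(m+1), xi] = S_m (m - mu); with the Leibniz rule mu
    cancels and [C_(m+1), xi] = m C_m ([commutator_mul_mxseries]).  This is a
    recursion of the same shape with mu = 0, whose only solution with constant
    term 1 is C = 1 ([R_adj_mul_R_sol]). *)

Lemma natrS_neq0 (K : fieldType) : [pchar K] =i pred0 ->
  forall m, m.+1%:R != 0 :> K.
Proof. by move=> /pcharf0P charK m; rewrite charK. Qed.

Lemma eq_rev_ord n (a b : 'I_n) : (b == rev_ord a) = (a == rev_ord b).
Proof. by rewrite -(inj_eq rev_ord_inj) rev_ordK eq_sym. Qed.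

(** * Commutator recursions in entries *)

Section CommutatorRecursion.
Variables (K : fieldType) (charK : [pchar K] =i pred0) (n : nat).
Implicit Types (c : K) (d : 'I_n -> K) (X : series 'M[K]_n).

(** The equation [X_(m+1), c J] = (m + diag d) X_m, with J the antidiagonal
    permutation matrix, read off entry by entry. *)
Definition commutator_eq c d X : Prop := forall m a b,
  c * (X m.+1 a (rev_ord b) - X m.+1 (rev_ord a) b) = (m%:R + d a) * X m a b.

Definition first_order_rec c d X : Prop := forall m a b,
  X m.+1 a b =
    (m.+1%:R - d a) * (m%:R + d a) / (2 * c * m.+1%:R) * X m a (rev_ord b).

(** The commutator changes sign under conjugation by J, so the equation at
    level m+1 gives a linear relation between the entries at (a, b) and
    (rev_ord a, rev_ord b), while the one at level m gives their difference;
    the two relations determine both entries because m+1 is invertible. *)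
Lemma commutator_eq_rec c d X :
  c != 0 -> (forall a, d (rev_ord a) = - d a) ->
  commutator_eq c d X -> first_order_rec c d X.
Proof.
move=> c0 dN eqX m a b.
have m1 := natrS_neq0 charK m; have two := natrS_neq0 charK 1.
have Ediff := eqX m a (rev_ord b); rewrite rev_ordK in Ediff.
have Esum : (m.+1%:R + d a) * X m.+1 a b
    + (m.+1%:R - d a) * X m.+1 (rev_ord a) (rev_ord b) = 0.
  rewrite -dN -(eqX m.+1) -(eqX m.+1) !rev_ordK; ring.
have D0 : 2 * c * m.+1%:R != 0 by rewrite !mulf_neq0.
apply: (mulfI D0).
rewrite [RHS]mulrA [_ * (_ / _)]mulrC divfK // -[RHS]mulrA -Ediff.
have -> : 2 * c * m.+1%:R * X m.+1 a b =
    c * ((m.+1%:R + d a) * X m.+1 a b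
          + (m.+1%:R - d a) * X m.+1 (rev_ord a) (rev_ord b))
    + (m.+1%:R - d a) * (c * (X m.+1 a b - X m.+1 (rev_ord a) (rev_ord b))).
  ring.
by rewrite Esum mulr0 add0r.
Qed.

(** The key is the relation between the entries at (a, b) and
    (rev_ord a, rev_ord b) that conjugation by J forces on any solution.  It
    holds at level 0 by assumption, the recursion propagates it, and in its
    presence the recursion turns back into the commutator equation. *)
Lemma rec_commutator_eq c d X :
  c != 0 -> (forall a, d (rev_ord a) = - d a) ->
  (forall a b, d a * X 0 a b = d a * X 0 (rev_ord a) (rev_ord b)) ->
  first_order_rec c d X -> commutator_eq c d X.
Proof.
move=> c0 dN X0 recX.
have two := natrS_neq0 charK 1.
have compat m a b :
    (m%:R + d a) * X m a b + (m%:R - d a) * X m (rev_ord a) (rev_ord b) = 0.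
  elim: m a b => [|m IHm] a b; first by rewrite !add0r mulNr X0 subrr.
  have /(canRL (addrK _)) := IHm a (rev_ord b).
  rewrite !recX !rev_ordK dN add0r opprK => E.
  rewrite [X in X + _](_ : _ = (m.+1%:R + d a) * (m.+1%:R - d a)
     / (2 * c * m.+1%:R) * ((m%:R + d a) * X m a (rev_ord b))); last by ring.
  rewrite E; ring.
move=> m a b; rewrite !recX rev_ordK dN.
have m1 := natrS_neq0 charK m.
have /(canRL (addKr _)) E := compat m a b.
rewrite [X in c * (_ - X)](_ : _ = (m.+1%:R + d a) / (2 * c * m.+1%:R) *
  ((m%:R - d a) * X m (rev_ord a) (rev_ord b))); last by ring.
rewrite E; field.
by rewrite nat1r m1 c0.
Qed.

Lemma first_order_rec_inj c d X Y :
  first_order_rec c d X -> first_order_rec c d Y -> X 0 = Y 0 -> X =1 Y.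
Proof.
move=> recX recY XY0; elim=> [//|m IHm].
by apply/matrixP=> a b; rewrite recX recY IHm.
Qed.

End CommutatorRecursion.

(** * Power series of matrices *)

Section MatrixSeriesAlgebra.
Variables (K : fieldType) (n : nat).
Implicit Types X Y Z : series 'M[K]_n.

(** Up to any given order, the product is that of truncated polynomials with
    matrix coefficients, whose associativity is known. *)
Lemma mul_mxseriesA X Y Z :
  mul_mxseries X (mul_mxseries Y Z) =1 mul_mxseries (mul_mxseries X Y) Z.
Proof.
case: n X Y Z => [|k] X Y Z N; first by apply/matrixP=> -[].
pose p W : {poly 'M[K]_k.+1} := \poly_(i < N.+1) W i.
have pE W i : (i <= N)%N -> (p W)`_i = W i.
  by move=> iN; rewrite coef_poly ltnS iN.
have pM V W i : (i <= N)%N -> (p V * p W)`_i = mul_mxseries V W i.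
  move=> iN; rewrite coefM; apply: eq_bigr => j _.
  by rewrite !pE // ?(leq_trans _ iN) ?leq_subr // -ltnS.
have lE (i : 'I_N.+1) : (i <= N)%N by rewrite -ltnS.
transitivity ((p X * (p Y * p Z))`_N); last rewrite mulrA; rewrite coefM.
  by apply: eq_bigr => i _; rewrite pE // pM ?leq_subr.
by apply: eq_bigr => i _; rewrite pE ?pM ?leq_subr.
Qed.

Lemma mul_mxseries1 X : mul_mxseries X (one_mxseries K n) =1 X.
Proof.
move=> m; rewrite /mul_mxseries big_ord_recr /= subnn mulmx1 big1 ?add0r //.
by move=> i _; rewrite /one_mxseries subn_eq0 leqNgt ltn_ord mulmx0.
Qed.

(** If Y X = 1 then E = X Y satisfies E X = X, and X can be cancelled
    coefficient by coefficient because its constant term is 1. *)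
Lemma left_inverse_mxseries X Y : X 0 = 1%:M ->
  mul_mxseries Y X =1 one_mxseries K n -> inverse_mxseries X Y.
Proof.
move=> X0 YX; split=> //.
set E := mul_mxseries X Y.
have EX m : mul_mxseries E X m = X m.
  rewrite -mul_mxseriesA -[RHS]mul_mxseries1; apply: eq_bigr => i _.
  by rewrite YX.
have E0 : E 0 = 1%:M.
  by have := EX 0; rewrite {1}/mul_mxseries big_ord1 X0 mulmx1.
elim/ltn_ind=> -[//|m] IHm.
have := EX m.+1; rewrite {1}/mul_mxseries big_ord_recl big_ord_recr /=.
rewrite E0 mul1mx subn0 big1 => [|i _]; last first.
  by rewrite IHm ?mul0mx // ltnS /bump leq0n add1n.
rewrite add0r /bump leq0n add1n subnn X0 mulmx1.
by rewrite -[RHS]addr0 => /addrI.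
Qed.

(** Leibniz rule for [-, A]: in the coefficient of z^(m+1), the terms
    Y_i (m-i+D) X_(m-i) and Y_i (i-D) X_(m-i) add up to m Y_i X_(m-i). *)
Lemma commutator_mul_mxseries (A D : 'M[K]_n) X Y :
  X 0 = 1%:M -> Y 0 = 1%:M ->
  (forall m, X m.+1 *m A - A *m X m.+1 = (m%:R%:M + D) *m X m) ->
  (forall m, Y m.+1 *m A - A *m Y m.+1 = Y m *m (m%:R%:M - D)) ->
  forall m, let C := mul_mxseries Y X in
    C m.+1 *m A - A *m C m.+1 = m%:R *: C m.
Proof.
move=> X0 Y0 eqX eqY m /=; rewrite /mul_mxseries.
have -> : (\sum_(i < m.+2) Y i *m X (m.+1 - i)%N) *m A
    - A *m (\sum_(i < m.+2) Y i *m X (m.+1 - i)%N) =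
    \sum_(i < m.+2) Y i *m (X (m.+1 - i)%N *m A - A *m X (m.+1 - i)%N)
    + \sum_(i < m.+2) (Y i *m A - A *m Y i) *m X (m.+1 - i)%N.
  rewrite mulmx_suml mulmx_sumr -sumrB -big_split; apply: eq_bigr => i _ /=.
  by rewrite mulmxBr mulmxBl !mulmxA addrA subrK.
(* The terms containing [X_0, A] and [Y_0, A] vanish. *)
rewrite big_ord_recr [X in _ + X]big_ord_recl /= subnn X0 Y0.
rewrite !mul1mx !mulmx1 !subrr mulmx0 mul0mx addr0 add0r -big_split scaler_sumr.
apply: eq_bigr => i _ /=; have im : (i <= m)%N by rewrite -ltnS.
rewrite /bump leq0n add1n subSS subSn // eqX eqY mulmxA -mulmxDl -mulmxDr.
rewrite addrACA subrr addr0 -raddfD /= -natrD subnK //.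
by rewrite mul_mx_scalar scalemxAl.
Qed.

(** A cross-shaped matrix series: where the two lines meet, the contributions
    add up, so the formula is safe exactly when the antidiagonal one vanishes
    there. *)
Lemma has_entries_cross X (diag anti : 'I_n -> series K) :
  (forall m b a, X m b a =
     diag a m *+ (b == a) + anti a m *+ (b == rev_ord a)) ->
  (forall a, rev_ord a = a ->
     diag a =1 one_series K /\ anti a =1 zero_series K) ->
  has_entries X diag anti.
Proof.
move=> XE mid; rewrite /has_entries /entry.
split=> [a m|a am m|a aE m|a b ba bra m]; rewrite XE.
- rewrite eqxx; case: eqP => [/esym/mid[_ ->]|_]; last by rewrite addr0.
  by rewrite addr0.
- by rewrite eqxx (negPf am) add0r.
- by have [-> ->] := mid a aE; rewrite eqxx mul0rn addr0.
- by rewrite (negPf ba) (negPf bra) addr0.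
Qed.

End MatrixSeriesAlgebra.

(** * The hypergeometric series *)

Section HypergeometricSeries.
Variables (K : fieldType) (charK : [pchar K] =i pred0) (r : nat).

Definition mu_coef (a : 'I_r.-1) : K :=
  (2 * (a : nat)%:R - r%:R + 2) / (2 * r%:R).

Lemma natr_rev_ord (a : 'I_r.-1) :
  (rev_ord a : nat)%:R = r%:R - 2 - (a : nat)%:R :> K.
Proof.
have -> : r%:R = (rev_ord a + a + 2)%N%:R :> K.
  by congr (_%:R); have := ltn_ord a; rewrite /=; lia.
rewrite !natrD; ring.
Qed.

Lemma mu_coef_rev a : mu_coef (rev_ord a) = - mu_coef a.
Proof. by rewrite /mu_coef natr_rev_ord; ring. Qed.

Lemma ord_natr_neq0 (a : 'I_r.-1) : r%:R != 0 :> K.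
Proof.
have rE : r = (r.-2).+2 by have := ltn_ord a; lia.
by rewrite rE; apply: natrS_neq0.
Qed.

Lemma B0 a : B K r a 0 = 1.
Proof. by rewrite /B big_geq // expr0 mulr1. Qed.

(** For i = m+1, the numbers 2r (i - mu_a) and 2r (i - 1 + mu_a) are the two
    linear factors (2i-1) r + 2 (a'+1) and (2i-1) r - 2 (a'+1) of the i-th term
    of the product, where a' = r-2-a. *)
Lemma B_rev_rec (a : 'I_r.-1) m :
  B K r (rev_ord a) m.+1 =
  - ((m.+1%:R - mu_coef a) * (m%:R + mu_coef a) / (4 * m.+1%:R))
    * B K r (rev_ord a) m.
Proof.
rewrite {1}/B big_nat_recr //= exprSr /B.
set P := \prod_(_ <= _ < _) _; set Q := _ ^+ m.
have r0 := ord_natr_neq0 a; have m0 := natrS_neq0 charK m.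
have two := natrS_neq0 charK 1.
rewrite /mu_coef natr_rev_ord -natr1 in m0 *.
have sixteen := natrS_neq0 charK 15; have four := natrS_neq0 charK 3.
field.
by rewrite m0 r0 four two.
Qed.

(** At the fixed point 2 (a+1) = r, so the factor i = 1 of the product is 0. *)
Lemma B_mid (a : 'I_r.-1) : rev_ord a = a -> B K r a =1 one_series K.
Proof.
move=> aE.
have mu0 : mu_coef a = 0.
  have /eqP := mu_coef_rev a; rewrite aE -subr_eq0 opprK -mulr2n -mulr_natl.
  by rewrite mulf_eq0 (negPf (natrS_neq0 charK 1)) => /eqP.
case=> [|m]; first exact: B0.
have := B_rev_rec a; rewrite aE => recB.
elim: m => [|m IHm]; rewrite recB.
  by rewrite mu0 addr0 mulr0 mul0r oppr0 mul0r.
by rewrite IHm mulr0.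
Qed.

Lemma B_even_odd_mid c (a : 'I_r.-1) : rev_ord a = a ->
  rescale c (Beven K r a) =1 one_series K /\
  rescale c (Bodd K r a) =1 zero_series K.
Proof.
move=> aE; rewrite /rescale /Beven /Bodd /even_part /odd_part.
split=> -[|m]; rewrite ?B_mid ?expr0 ?mulr1 ?mul0r //=.
  by rewrite /one_series /=; case: ifP; rewrite mul0r.
by rewrite /one_series /=; case: ifP; rewrite mul0r.
Qed.

End HypergeometricSeries.

(** * The solution and its inverse *)

Section Solution.
Variables (K : fieldType) (charK : [pchar K] =i pred0) (r : nat) (s : K).
Hypothesis s_neq0 : s != 0.

Lemma mulmx_xi (X : 'M[K]_r.-1) a b :
  (X *m xi r s) a b = 2 * s ^+ r * X a (rev_ord b).
Proof.
rewrite mxE (bigD1 (rev_ord b)) //= big1 ?addr0 => [|c cb].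
  by rewrite mxE rev_ordK eqxx mulrC.
by rewrite mxE -(inj_eq rev_ord_inj) rev_ordK eq_sym (negPf cb) mulr0.
Qed.

Lemma xi_mulmx (X : 'M[K]_r.-1) a b :
  (xi r s *m X) a b = 2 * s ^+ r * X (rev_ord a) b.
Proof.
rewrite mxE (bigD1 (rev_ord a)) //= big1 ?addr0 => [|c ca].
  by rewrite mxE eqxx.
by rewrite mxE (negPf ca) mul0r.
Qed.

Lemma commutator_xi (X : 'M[K]_r.-1) a b :
  (X *m xi r s - xi r s *m X) a b =
  2 * s ^+ r * (X a (rev_ord b) - X (rev_ord a) b).
Proof. by rewrite mxE [X in _ + X]mxE mulmx_xi xi_mulmx mulrBr. Qed.

Lemma commutator_eqP (X : series 'M[K]_r.-1) :
  (forall m, X m.+1 *m xi r s - xi r s *m X m.+1 = (m%:R%:M + mu K r) *m X m)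
  <-> commutator_eq (2 * s ^+ r) (@mu_coef K r) X.
Proof.
have muE m a b : ((m%:R%:M + mu K r) *m X m) a b =
    (m%:R + mu_coef K a) * X m a b.
  by rewrite -diag_const_mx -raddfD /= mul_diag_mx !mxE.
split=> [eqX m a b | eqX m]; first by rewrite -commutator_xi eqX muE.
by apply/matrixP=> a b; rewrite commutator_xi muE.
Qed.

(** The closed form of the recursion: the last factor is the (a, b) entry of
    the m-th power of the antidiagonal involution. *)
Definition R_sol : series 'M[K]_r.-1 := fun m => \matrix_(a, b)
  ((-1) ^+ m * B K r (rev_ord a) m * (s ^- r) ^+ m
    * (b == if odd m then rev_ord a else a)%:R).

(** The adjoint of R(-z) for the pairing whose Gram matrix is antidiagonal:
    transposition followed by reversal of rows and columns. *)
Definition R_adj : series 'M[K]_r.-1 := fun m => \matrix_(a, b)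
  ((-1) ^+ m * R_sol m (rev_ord b) (rev_ord a)).

Lemma xi_coef_neq0 : 2 * s ^+ r != 0.
Proof. by rewrite mulf_neq0 ?expf_neq0 ?(natrS_neq0 charK 1). Qed.

Lemma R_sol0 : R_sol 0 = 1%:M.
Proof. by apply/matrixP=> a b; rewrite !mxE B0 !expr0 !mul1r eq_sym. Qed.

Lemma R_sol_rec : first_order_rec (2 * s ^+ r) (@mu_coef K r) R_sol.
Proof.
move=> m a b; rewrite !mxE B_rev_rec //.
have -> : (b == if odd m.+1 then rev_ord a else a) =
          (rev_ord b == if odd m then rev_ord a else a).
  by rewrite /=; case: (odd m); rewrite /= -(inj_eq rev_ord_inj) ?rev_ordK.
have m0 := natrS_neq0 charK m; have two := natrS_neq0 charK 1.
have four := natrS_neq0 charK 3.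
rewrite !exprSr; field.
by rewrite nat1r m0 expf_neq0 // two four.
Qed.

Lemma R_sol_commutator : commutator_eq (2 * s ^+ r) (@mu_coef K r) R_sol.
Proof.
apply: rec_commutator_eq => //.
- exact: xi_coef_neq0.
- exact: mu_coef_rev.
- by move=> a b; rewrite R_sol0 !mxE (inj_eq rev_ord_inj).
- exact: R_sol_rec.
Qed.

Lemma R_sol_solution : solution s R_sol.
Proof. split; [exact: R_sol0 | exact/commutator_eqP/R_sol_commutator]. Qed.

Lemma solution_uniq X : solution s X -> X =1 R_sol.
Proof.
case=> X0 /commutator_eqP eqX.
apply: (@first_order_rec_inj _ _ (2 * s ^+ r) (@mu_coef K r)).
- by apply: commutator_eq_rec eqX => //;
    [exact: xi_coef_neq0 | exact: mu_coef_rev].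
- exact: R_sol_rec.
- by rewrite X0 R_sol0.
Qed.

Lemma R_adj0 : R_adj 0 = 1%:M.
Proof.
by apply/matrixP=> a b; rewrite mxE R_sol0 !mxE mul1r
  (inj_eq rev_ord_inj) eq_sym.
Qed.

(** The adjoint fixes xi, negates mu and reverses products; the sign of R(-z)
    compensates the one coming from the reversed commutator. *)
Lemma R_adj_commutator m :
  R_adj m.+1 *m xi r s - xi r s *m R_adj m.+1 = R_adj m *m (m%:R%:M - mu K r).
Proof.
apply/matrixP=> a b.
rewrite commutator_xi -diag_const_mx -raddfB mul_mx_diag /=.
have := R_sol_commutator m (rev_ord b) (rev_ord a).
rewrite mu_coef_rev !rev_ordK => E.
have adjE k i j : R_adj k i j = (-1) ^+ k * R_sol k (rev_ord j) (rev_ord i).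
  by rewrite mxE.
rewrite [RHS]mxE !adjE !rev_ordK exprSr.
rewrite [X in _ = _ * X](_ : _ = m%:R - mu_coef K b); last by rewrite !mxE.
rewrite [RHS]mulrAC -[RHS]mulrA -E; ring.
Qed.

(** With mu gone, the recursion for the product has the factor m in passing
    from C_m to C_(m+1), which kills C_1 and hence all later coefficients. *)
Lemma R_adj_mul_R_sol : mul_mxseries R_adj R_sol =1 one_mxseries K r.-1.
Proof.
have eqC := commutator_mul_mxseries R_sol0 R_adj0
  (R_sol_solution.2) R_adj_commutator.
have /commutator_eq_rec recC :
    commutator_eq (2 * s ^+ r) (fun=> 0) (mul_mxseries R_adj R_sol).
  by move=> m a b; rewrite -commutator_xi eqC mxE addr0.
have {}recC := recC charK xi_coef_neq0 (fun=> esym (oppr0 _)).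
case=> [|m]; first by rewrite /mul_mxseries big_ord1 R_sol0 R_adj0 mulmx1.
apply/matrixP; elim: m => [|m IHm] a b; rewrite recC ?IHm !mxE.
  by rewrite addr0 mulr0 !mul0r.
by rewrite mulr0.
Qed.

Lemma R_sol_entries : has_entries R_sol
  (fun a => rescale (s ^- r) (Beven K r (rev_ord a)))
  (fun a => opp_series (rescale (s ^- r) (Bodd K r a))).
Proof.
apply: has_entries_cross => [m b a|a aE]; last first.
  have [E O] := B_even_odd_mid charK (s ^- r) aE.
  by rewrite aE; split=> // m; rewrite /opp_series O oppr0.
rewrite mxE /rescale /opp_series /Beven /Bodd /even_part /odd_part -signr_odd.
rewrite eq_rev_ord (eq_sym b a) mulr_natr; case: (odd m).
  case: eqP => [->|_]; last by rewrite mul0r mul0rn addr0.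
  by rewrite mul0r mul0rn add0r expr1 mulN1r mulNr.
by case: eqP => [->|_]; rewrite mul0r oppr0 mul0rn addr0 // expr0 mul1r.
Qed.

Lemma R_adj_entries : has_entries R_adj
  (fun a => rescale (s ^- r) (Beven K r a))
  (fun a => rescale (s ^- r) (Bodd K r a)).
Proof.
apply: has_entries_cross => [m b a|a aE]; last exact: B_even_odd_mid.
rewrite /rescale /Beven /Bodd /even_part /odd_part !mxE rev_ordK.
move: (B K r a m) => Bam; rewrite !mulrA -expr2 sqrr_sign mul1r mulr_natr.
case: (odd m); rewrite mul0r mul0rn ?addr0 ?add0r.
  by rewrite [in RHS]eq_rev_ord [rev_ord b == a]eq_sym.
by rewrite (inj_eq rev_ord_inj) eq_sym.
Qed.

End Solution.

Theorem proposition2p2 (K : fieldType) (charK : [pchar K] =i pred0)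
    (r : nat) (r_ge2 : (2 <= r)%N)
    (phi : rat) (phi_neq0 : phi != 0)
    (s : K) (s_sqrt : s ^+ 2 = ratr phi) :
  exists R : series 'M[K]_(r.-1),
    [/\ solution s R,
        forall R' : series 'M[K]_(r.-1), solution s R' -> R' =1 R,
        has_entries R
          (fun a => rescale (s ^- r) (Beven K r (rev_ord a)))
          (fun a => opp_series (rescale (s ^- r) (Bodd K r a))) &
        exists S : series 'M[K]_(r.-1),
          inverse_mxseries R S /\
          has_entries S
            (fun a => rescale (s ^- r) (Beven K r a))
            (fun a => rescale (s ^- r) (Bodd K r a))].
Proof.
have s_neq0 : s != 0.
  have -> : (s != 0) = (s ^+ 2 != 0) by rewrite expf_eq0.
  rewrite s_sqrt.
  have intr_neq0 (k : int) : k != 0 -> k%:~R != 0 :> K.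
    case: k => [[|k]|k] // _; first exact: natrS_neq0.
    by rewrite NegzE mulrNz oppr_eq0; exact: natrS_neq0.
  by rewrite /ratr mulf_neq0 ?invr_neq0 // intr_neq0 ?numq_eq0 ?denq_eq0.
exists (R_sol r s); split.
- exact: R_sol_solution.
- exact: solution_uniq.
- exact: R_sol_entries.
- exists (R_adj r s); split; last exact: R_adj_entries.
  by apply: left_inverse_mxseries; [exact: R_sol0 | exact: R_adj_mul_R_sol].
Qed.
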